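(* Let $\{X, X_n;\ n \geq 1\}$ be a sequence of i.i.d. real-valued random variables such that $\mathbb{E}X = 0$ and $\mathbb{E}X^2 = 1$. Let $\{X', X'_n;\ n \geq 1\}$ be an independent copy of $\{X, X_n;\ n \geq 1\}$. Then, for any given $\epsilon > 0$, $$\mathbb{P}\left( \frac{\sum_{k=1}^{n} (X_k - X'_k)^2}{\sum_{k=1}^{n} X_k^2} > 1 - \epsilon \right) = 1 - o\left( n^{-1} \right) \quad \text{as } n \to \infty.$$
   Context: The notation $1 - o(n^{-1})$ means that $n\left(1 - \mathbb{P}(\cdot)\right) \to 0$ as $n\to\infty$. An independent copy of a family of random variables is a family independent of it and with the same joint distribution. A ratio whose denominator vanishes is taken to be $0$. *)

(* Defs.v *)
From HB Require Import structures.
From mathcomp Require Import all_boot all_order all_algebra.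
From mathcomp Require Import all_classical all_reals all_analysis.

Set Implicit Arguments.
Unset Strict Implicit.
Unset Printing Implicit Defensive.

Import Order.TTheory GRing.Theory Num.Theory.
Import numFieldNormedType.Exports.

Local Open Scope classical_set_scope.
Local Open Scope ring_scope.

(* Measures are total functions on [set T], with meaningless values off the
   sigma-algebra; equality in law is therefore tested on Borel sets only. *)
Definition identically_distributed d (T : measurableType d) (R : realType)
    (P : probability T R) (I : Type) (X : I -> {RV P >-> R}) : Prop :=
  forall (i j : I) (A : set R), measurable A ->
    distribution P (X i) A = distribution P (X j) A.

Definition mutually_independent d (T : measurableType d) (R : realType)
    (P : probability T R) (I : choiceType) (X : I -> {RV P >-> R}) : Prop :=
  forall (s : seq I) (A : I -> set R), uniq s -> (forall i, measurable (A i)) ->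
    P (\bigcap_(i in [set` s]) (X i @^-1` A i))
    = (\prod_(i <- s) P (X i @^-1` A i))%E.

Definition iid d (T : measurableType d) (R : realType)
    (P : probability T R) (I : choiceType) (X : I -> {RV P >-> R}) : Prop :=
  mutually_independent X /\ identically_distributed X.

Definition sigma_family (T : Type) (R : realType) (I : Type)
    (X : I -> T -> R) : set (set T) :=
  <<s \bigcup_(i in [set: I]) preimage_set_system [set: T] (X i) measurable >>.

Definition cylinder_sigma_algebra (R : realType) (I : Type) :
    set (set (I -> R)) :=
  sigma_family (fun (i : I) (x : I -> R) => x i).

Definition independent_families d (T : measurableType d) (R : realType)
    (P : probability T R) (I J : Type)
    (X : I -> {RV P >-> R}) (Y : J -> {RV P >-> R}) : Prop :=
  forall A B : set T,
    sigma_family (fun i => X i : T -> R) A ->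
    sigma_family (fun j => Y j : T -> R) B ->
    P (A `&` B) = (P A * P B)%E.

Definition same_joint_distribution d (T : measurableType d) (R : realType)
    (P : probability T R) (I : Type) (X Y : I -> {RV P >-> R}) : Prop :=
  forall B : set (I -> R), cylinder_sigma_algebra B ->
    P ((fun w i => X i w) @^-1` B) = P ((fun w i => Y i w) @^-1` B).

Definition independent_copy d (T : measurableType d) (R : realType)
    (P : probability T R) (I : Type) (X Y : I -> {RV P >-> R}) : Prop :=
  independent_families X Y /\ same_joint_distribution X Y.

(* Main.v *)
(* Since [sum (X_k - X'_k)^2 <= sum X_k^2] means [sum X'_k^2 <= 2 sum X_k X'_k],
   the complement of the event forces [sum X_k^2 <= a n], [sum X'_k^2 <= b n] or
   [sum X_k X'_k >= b n / 2]. Each of these is an upper deviation of order n for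
   i.i.d. variables Y with nonpositive mean and finite second moment: the
   products [X_k X'_k] have mean 0 and variance 1, and in the first two events
   [x^2] is replaced by the smaller bounded function [min (x^2, 1)], which has
   positive mean. Such a deviation has probability o(1/n): truncate the summands
   above at [c n / 4]. Some truncation is active with probability at most
   [n P(Y > c n / 4)], which is o(1/n) because [E Y^2] is finite, and Chernoff's
   bound with parameter [2 ln n / (c n)] gives O(1/n^2) for truncated sums. *)
Require Import Defs.
From HB Require Import structures.
From mathcomp Require Import all_boot all_order all_algebra.
From mathcomp Require Import all_classical all_reals all_analysis.
From mathcomp Require Import measurable_realfun ring lra.

Import Order.TTheory GRing.Theory Num.Theory.
Import numFieldNormedType.Exports.

Local Open Scope classical_set_scope.
Local Open Scope ring_scope.

Set Implicit Arguments.
Unset Strict Implicit.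
Unset Printing Implicit Defensive.

(** * Independence and product measures *)

(** Rectangles form a π-system that generates the product σ-algebra and contains the whole space, so
    the uniqueness theorem for finite measures applies. *)
Lemma eq_measure_rectangles d1 d2 (T1 : measurableType d1)
    (T2 : measurableType d2) (R : realType)
    (m1 m2 : {measure set (T1 * T2) -> \bar R}) :
  (m1 setT < +oo)%E ->
  (forall A B, measurable A -> measurable B -> m1 (A `*` B) = m2 (A `*` B)) ->
  forall D, measurable D -> m1 D = m2 D.
Proof.
move=> m1oo m12 D mD.
pose C : set (set (T1 * T2)) :=
  [set C | exists A, measurable A /\ exists B, measurable B /\ C = A `*` B].
apply: (measure_unique C (fun=> setT)) => //.
- rewrite measurable_prod_measurableType; congr (<<s _ >>).
  rewrite predeqE; split => [[A mA [B mB <-]]|[A [mA [B [mB ->]]]]].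
    by exists A; split => //; exists B.
  by exists A => //; exists B.
- move=> _ _ [A1 [mA1 [B1 [mB1 ->]]]] [A2 [mA2 [B2 [mB2 ->]]]].
  rewrite -setXI; exists (A1 `&` A2); split; first exact: measurableI.
  by exists (B1 `&` B2); split => //; exact: measurableI.
- move=> _; exists setT; split => //; exists setT; split => //.
  by rewrite setXTT.
- by rewrite bigcup_const//; exists 0%N.
- by move=> _ [A [mA [B [mB ->]]]]; exact: m12.
Qed.

(** Both sides are finite measures in [D]: the law of [W] restricted to [C], and the law of [W]
    scaled by the number [P C]. Rectangles therefore decide. *)
Lemma independent_event_rectangles d d1 d2 (T : measurableType d)
    (T1 : measurableType d1) (T2 : measurableType d2) (R : realType)
    (P : probability T R) (W : T -> T1 * T2) (C : set T) :
  measurable_fun setT W -> measurable C ->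
  (forall A B, measurable A -> measurable B ->
    P (W @^-1` (A `*` B) `&` C) = P (W @^-1` (A `*` B)) * P C)%E ->
  forall D, measurable D -> (P (W @^-1` D `&` C) = P (W @^-1` D) * P C)%E.
Proof.
move=> mW mC WC D mD.
have PC0 : 0 <= fine (P C) by rewrite fine_ge0.
pose WM : {mfun T >-> (T1 * T2)%type} :=
  HB.pack W (isMeasurableFun.Build _ _ _ _ W mW).
have := @eq_measure_rectangles _ _ T1 T2 R
  (pushforward (mrestr P mC) WM)
  (mscale (NngNum PC0) (pushforward P WM)).
rewrite /= /mscale/= /pushforward/= /mrestr/= fineK ?fin_num_measure//.
rewrite [RHS]muleC; apply => //.
  rewrite preimage_setT setTI -ge0_fin_numE// fin_num_measure//.
by move=> A B mA mB; rewrite muleC WC.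
Qed.

(** Independence makes the law of the pair the product of the two laws, and Tonelli's theorem splits
    the integral. *)
Lemma expectation_prod_independent d d1 d2 (T : measurableType d)
    (T1 : measurableType d1) (T2 : measurableType d2) (R : realType)
    (P : probability T R) (U : {mfun T >-> T1}) (V : {mfun T >-> T2})
    (f : T1 -> \bar R) (g : T2 -> \bar R) :
  (forall A B, measurable A -> measurable B ->
    P (U @^-1` A `&` V @^-1` B) = P (U @^-1` A) * P (V @^-1` B))%E ->
  measurable_fun [set: T1] f -> measurable_fun [set: T2] g ->
  (forall x, 0 <= f x)%E -> (forall y, 0 <= g y)%E ->
  (\int[P]_w (f (U w) * g (V w)) = \int[P]_w f (U w) * \int[P]_w g (V w))%E.
Proof.
move=> UV mf mg f0 g0.
pose W w := (U w, V w).
have mW : measurable_fun setT W by exact: measurable_fun_pair.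
pose WM : {mfun T >-> (T1 * T2)%type} :=
  HB.pack W (isMeasurableFun.Build _ _ _ _ W mW).
pose h (z : T1 * T2) := (f z.1 * g z.2)%E.
have mh : measurable_fun [set: T1 * T2] h.
  apply: emeasurable_funM.
    exact: (measurableT_comp mf measurable_fst).
  exact: (measurableT_comp mg measurable_snd).
have h0 z : (0 <= h z)%E by exact: mule_ge0.
transitivity (\int[distribution P WM]_z h z)%E.
  by rewrite ge0_integral_distribution.
rewrite (eq_measure_integral (distribution P U \x distribution P V)%E);
    last first.
  move=> D mD _; apply/esym.
  by apply: product_measure_unique => // A B mA mB; exact: UV.


rewrite fubini_tonelli1//.
rewrite -[X in (_ = X * _)%E](ge0_integral_distribution U)//.
rewrite -[X in (_ = _ * X)%E](ge0_integral_distribution V)//.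
rewrite -ge0_integralZr//; last exact: integral_ge0.
by apply: eq_integral => x _; rewrite /fubini_F/h/= ge0_integralZl.
Qed.

Lemma bigcap_seq_cons (T : Type) (I : choiceType) (x : I) (s : seq I)
    (F : I -> set T) :
  \bigcap_(i in [set` x :: s]) F i = F x `&` \bigcap_(i in [set` s]) F i.
Proof.
rewrite -bigcap_setU1; congr (\bigcap_(i in _) _); apply/seteqP.
by split=> i /=; rewrite inE => /predU1P.
Qed.

(** For a function [h] of a pair, the preimage of a Borel set is rarely a rectangle, whereas the
    independence hypotheses only speak of rectangles. This closes the gap for whole sequences of
    pairs. *)
Lemma independent_seq_rectangles d d1 d2 (T : measurableType d)
    (T1 : measurableType d1) (T2 : measurableType d2) (R : realType)
    (P : probability T R) (I : choiceType)
    (W : I -> {mfun T >-> (T1 * T2)%type}) :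
  (forall (s : seq I) (A : I -> set T1) (B : I -> set T2), uniq s ->
    (forall i, measurable (A i)) -> (forall i, measurable (B i)) ->
    P (\bigcap_(i in [set` s]) (W i @^-1` (A i `*` B i)))
    = \prod_(i <- s) P (W i @^-1` (A i `*` B i)))%E ->
  forall (s : seq I) (D : I -> set (T1 * T2)), uniq s ->
    (forall i, measurable (D i)) ->
    (P (\bigcap_(i in [set` s]) (W i @^-1` D i))
    = \prod_(i <- s) P (W i @^-1` D i))%E.
Proof.
move=> rect s2 D us2 mD.
have mWD i E : measurable E -> measurable (W i @^-1` E).
  by move=> mE; exact: measurable_funPTI.
(* The rectangles on [s1] are traded for arbitrary sets one index at a time. *)
suff : forall s1, uniq (s1 ++ s2) ->
    (forall i, i \in s1 -> exists A B,
      [/\ measurable A, measurable B & D i = A `*` B]) ->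
    (P (\bigcap_(i in [set` s1 ++ s2]) (W i @^-1` D i))
    = \prod_(i <- s1 ++ s2) P (W i @^-1` D i))%E.
  by move=> /(_ [::]); apply.
elim: s2 {us2} D mD => [|x s2 IH] D mD s1 us12 Ds1.
  rewrite cats0 in us12 *.
  (* [rect] wants measurable sides at every index, so both sides are the whole space off [s1]. *)
  have /choice[F HF] : forall i, exists F : set T1 * set T2,
      [/\ measurable F.1, measurable F.2 & i \in s1 -> D i = F.1 `*` F.2].
    move=> i; have [/Ds1[A [B [mA mB DE]]]|/negP is1] := boolP (i \in s1).
      by exists (A, B).
    by exists (setT, setT); split => //=.
  rewrite (eq_bigcapr (G := fun i => W i @^-1` ((F i).1 `*` (F i).2)));
      last first.
    by move=> i /= is1; have [_ _ /(_ is1) ->] := HF i.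
  rewrite rect//; [|by move=> i; case: (HF i)..].
  by apply: eq_big_seq => i is1; have [_ _ /(_ is1) ->] := HF i.
have pxs : perm_eq (s1 ++ x :: s2) (x :: s1 ++ s2).
  by rewrite -[x :: s2]cat1s perm_catCA.
have [xs us] : x \notin s1 ++ s2 /\ uniq (s1 ++ s2).
  by move: us12; rewrite (perm_uniq pxs) /= => /andP[].
rewrite (perm_big _ pxs)/= big_cons.
have -> : [set` s1 ++ x :: s2] = [set` x :: s1 ++ s2].
  by apply/seteqP; split => i /=; rewrite (perm_mem pxs).
rewrite bigcap_seq_cons.
set C := \bigcap_(i in [set` s1 ++ s2]) (W i @^-1` D i).
have mC : measurable C.
  apply: fin_bigcap_measurable => [|i _]; first exact: finite_seq.
  exact: mWD.
(* For a rectangle [E], the induction hypothesis is used with [x] moved to the front list and [D x]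
   replaced by [E]. The case [E = setT] then evaluates [P C]. *)
have key E : (exists A B, [/\ measurable A, measurable B & E = A `*` B]) ->
    (P (W x @^-1` E `&` C) =
     P (W x @^-1` E) * \prod_(i <- s1 ++ s2) P (W i @^-1` D i))%E.
  move=> EAB; pose D' i := if i == x then E else D i.
  have D'x : D' x = E by rewrite /D' eqxx.
  have D'D i : i \in s1 ++ s2 -> D' i = D i.
    by move=> is12; rewrite /D'; case: eqP => // ix; rewrite -ix is12 in xs.
  have mD' i : measurable (D' i).
    rewrite /D'; case: eqP => // _; have [A [B [mA mB ->]]] := EAB.
    exact: measurableX.
  have := IH D' mD' (x :: s1); rewrite /= xs us => /(_ isT).
  rewrite bigcap_seq_cons big_cons D'x.
  rewrite (eq_bigcapr (G := fun i => W i @^-1` D i)); last first.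
    by move=> i /= /D'D ->.
  rewrite (eq_big_seq (fun i => P (W i @^-1` D i))); last first.
    by move=> i /= /D'D ->.
  apply=> i; rewrite inE => /predU1P[->|is1].
    by rewrite D'x.
  by rewrite D'D ?mem_cat ?is1//; exact: Ds1.
have PC : (P C = \prod_(i <- s1 ++ s2) P (W i @^-1` D i))%E.
  have := key setT; rewrite preimage_setT setTI probability_setT mul1e; apply.
  by exists setT, setT; split => //; rewrite setXTT.
rewrite -PC; apply: independent_event_rectangles => // A B mA mB.
by rewrite key ?PC//; exists A, B.
Qed.

(** * Exponential moments of sums of independent variables *)

Lemma measurable_partial_sum d (T : measurableType d) (R : realType)
    (Y : nat -> {mfun T >-> R}) (n : nat) :
  measurable_fun setT (fun w => \sum_(1 <= k < n.+1) Y k w).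
Proof. by apply: measurable_sum => k; exact: measurable_funPT. Qed.

(** Induction on [n] with the list of later indices left free. The new sum is a function of the pair
    of the old sum and [Y n.+1]; on rectangles for this pair, the event on [Y n.+1] joins the list
    of later events. *)
Lemma partial_sum_independent d (T : measurableType d) (R : realType)
    (P : probability T R) (Y : nat -> {RV P >-> R}) (n : nat) (s : seq nat)
    (A : nat -> set R) (B : set R) :
  mutually_independent Y -> uniq s -> (forall i, i \in s -> (n < i)%N) ->
  (forall i, measurable (A i)) -> measurable B ->
  (P ((fun w => \sum_(1 <= k < n.+1) Y k w)%R @^-1` B
      `&` \bigcap_(i in [set` s]) (Y i @^-1` A i)) =
   P ((fun w => \sum_(1 <= k < n.+1) Y k w)%R @^-1` B)
   * P (\bigcap_(i in [set` s]) (Y i @^-1` A i)))%E.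
Proof.
move=> Yi us ns mA mB.
elim: n s us ns A B mA mB => [|n IH] s us ns A B mA mB.
  under eq_fun do rewrite big_geq//.
  rewrite preimage_cst; case: ifPn => _.
    by rewrite setTI probability_setT mul1e.
  by rewrite set0I measure0 mul0e.
set S := (X in P (X @^-1` _ `&` _)).
pose S' w := \sum_(1 <= k < n.+1) Y k w.
pose W w := (S' w, Y n.+1 w).
have mW : measurable_fun setT W.
  by apply: measurable_fun_pair => //; exact: measurable_partial_sum.
pose add (z : R * R) := z.1 + z.2.
have madd : measurable_fun setT add by exact: measurable_funD.
have SE C : S @^-1` C = W @^-1` (add @^-1` C).
  by apply/seteqP; split=> w; rewrite /S /= big_nat_recr.
rewrite SE; set C := \bigcap_(i in _) _.
have mYA i E : measurable E -> measurable (Y i @^-1` E).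
  by move=> mE; exact: measurable_funPTI.
have mC : measurable C.
  apply: fin_bigcap_measurable => [|i _]; first exact: finite_seq.
  exact: mYA.
apply: independent_event_rectangles => //; last first.
  by rewrite -[X in measurable X]setTI; exact: madd.
move=> E F mE mF.
have n1s : n.+1 \notin s by apply/negP => /ns; rewrite ltnn.
pose A' i := if i == n.+1 then F else A i.
have mA' i : measurable (A' i) by rewrite /A'; case: ifP.
have A'n : A' n.+1 = F by rewrite /A' eqxx.
have A'A i : i \in s -> A' i = A i.
  by move=> is1; rewrite /A'; case: eqP => // iE; rewrite -iE is1 in n1s.
have WEF : W @^-1` (E `*` F) = S' @^-1` E `&` Y n.+1 @^-1` F by [].
rewrite WEF.
have CE : C = \bigcap_(i in [set` s]) (Y i @^-1` A' i).
  by apply: eq_bigcapr => i /= /A'A ->.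
(* [H1] separates the old sum from [Y n.+1] and the later variables together, [H2] from [Y n.+1]
   alone. Mutual independence then separates [Y n.+1] from the later ones. *)
have := IH (n.+1 :: s) _ _ A' E mA' mE; rewrite /= n1s us => /(_ isT) H1.
rewrite bigcap_seq_cons A'n -CE setIA in H1.
rewrite H1; last by move=> i; rewrite inE => /predU1P[->//|/ns/ltnW].
have := IH [:: n.+1] _ _ A' E mA' mE => /(_ isT) H2.
rewrite bigcap_seq_cons A'n set_nil bigcap_set0 setIT in H2.
rewrite H2; last by move=> i; rewrite inE => /eqP ->.
rewrite -muleA; congr (_ * _)%E.
have := Yi (n.+1 :: s) A'; rewrite /= n1s us => /(_ isT mA').
rewrite bigcap_seq_cons big_cons A'n -CE => ->.
by congr (_ * _)%E; rewrite CE Yi.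
Qed.

(** The last factor is independent of the partial sum, so the factors split off one by one. *)
Lemma mmt_gen_fun_sum d (T : measurableType d) (R : realType)
    (P : probability T R) (Y : nat -> {RV P >-> R}) (r : R) (n : nat) :
  mutually_independent Y ->
  (\int[P]_w (expR (r * \sum_(1 <= k < n.+1) Y k w))%:E =
   \prod_(1 <= k < n.+1) \int[P]_w (expR (r * Y k w))%:E)%E.
Proof.
move=> Yi; elim: n => [|n IH].
  rewrite big_geq//; under eq_integral do rewrite big_geq// mulr0 expR0.
  by rewrite integral_cst//= probability_setT mule1.
rewrite big_nat_recr//= -IH.
pose S w := \sum_(1 <= k < n.+1) Y k w.
pose SM : {mfun T >-> R} :=
  HB.pack S (isMeasurableFun.Build _ _ _ _ S (measurable_partial_sum Y n)).
have mexp : measurable_fun [set: R] (fun x => (expR (r * x))%:E).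
  apply/measurable_EFinP.
  by apply: measurableT_comp => //; exact: mulrl_measurable.
rewrite -(@expectation_prod_independent _ _ _ _ _ _ _ P SM (Y n.+1)
  _ _ _ mexp mexp).
- apply: eq_integral => w _.
  by rewrite -EFinM -expRD -mulrDr big_nat_recr.
- move=> A B mA mB.
  have := partial_sum_independent (s := [:: n.+1]) (A := fun=> B) (B := A)
    Yi isT.
  rewrite bigcap_seq_cons set_nil bigcap_set0 setIT; apply => //.
  by move=> i; rewrite inE => /eqP ->.
- by move=> x; rewrite lee_fin expR_ge0.
- by move=> x; rewrite lee_fin expR_ge0.
Qed.

(** * Truncation and Chernoff's bound *)

(** The bound [1 + y <= expR y] at [y = - x] gives [expR x - 1 - x <= x * (expR x - 1)]. The right
    side is at most [x ^+ 2 * expR x] for [x >= 0], and at most [x ^+ 2] for [x < 0] by the same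
    bound at [y = x]. *)
Lemma expR_le_quadratic (R : realType) (b x : R) :
  0 <= b -> x <= b -> expR x <= 1 + x + x ^+ 2 * expR b.
Proof.
move=> b0 xb.
have e1 : expR x - 1 <= x * expR x.
  have := expR_ge1Dx (- x); rewrite -(ler_pM2r (expR_gt0 x)) expRN.
  rewrite mulVf ?gt_eqF ?expR_gt0// mulrDl mul1r mulNr; lra.
have e2 := expR_ge1Dx x.
have eb : expR x <= expR b by rewrite ler_expR.
have e1b : 1 <= expR b by have := expR_ge1Dx b; lra.
suff : expR x - 1 - x <= x ^+ 2 * expR b by lra.
have [x0|x0] := leP 0 x.
  apply: (@le_trans _ _ (x * (expR x - 1))).
    by rewrite mulrBr mulr1 lerD2r.
  by rewrite expr2 -mulrA ler_wpM2l// (le_trans e1)// ler_wpM2l.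
apply: (@le_trans _ _ (x ^+ 2)); last by rewrite ler_peMr// sqr_ge0.
have : x * (expR x - 1) <= x ^+ 2.
  by rewrite expr2; apply: ler_wnM2l; [exact: ltW|lra].
by move: e1; lra.
Qed.

(** The cut is one-sided because only upper deviations are estimated. A cut value becomes [0], where
    the exponential is [1]. *)
Definition truncate_above (R : realType) (b x : R) : R :=
  if x <= b then x else 0.

Lemma measurable_truncate_above (R : realType) (b : R) :
  measurable_fun [set: R] (truncate_above b).
Proof. by apply: measurable_fun_ifT => //; exact: measurable_fun_ler. Qed.

(** The pointwise bound [1 + r * x + c * x ^+ 2] is in terms of the untruncated [x]: above the cut
    the left side is [1] and [x >= 0]. Integration can thus drop the linear term by the sign of the
    mean of [Y] itself, and [1 + c * s2 <= expR (c * s2)] finishes. *)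
Lemma mmt_gen_fun_truncate_above d (T : measurableType d) (R : realType)
    (P : probability T R) (Y : {RV P >-> R}) (s2 b r : R) :
  0 <= b -> 0 <= r ->
  P.-integrable setT (EFin \o Y) ->
  P.-integrable setT (fun w => (Y w ^+ 2)%:E) ->
  (\int[P]_w (Y w)%:E <= 0)%E ->
  (\int[P]_w (Y w ^+ 2)%:E <= s2%:E)%E ->
  (\int[P]_w (expR (r * truncate_above b (Y w)))%:E
   <= (expR (r ^+ 2 * expR (r * b) * s2))%:E)%E.
Proof.
move=> b0 r0 iY iY2 EY EY2.
pose c := r ^+ 2 * expR (r * b).
have c0 : 0 <= c by rewrite mulr_ge0 ?sqr_ge0 ?expR_ge0.
have bound x : expR (r * truncate_above b x) <= 1 + r * x + c * x ^+ 2.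
  rewrite /truncate_above; have [xb|xb] := leP x b.
    have := expR_le_quadratic (mulr_ge0 r0 b0) (ler_wpM2l r0 xb).
    by rewrite /c exprMn mulrAC.
  have x0 : 0 <= x by rewrite (le_trans b0)// ltW.
  by rewrite mulr0 expR0 -addrA lerDl addr_ge0// mulr_ge0// sqr_ge0.
have i1 : P.-integrable setT (cst (1%:E : \bar R)).
  exact: finite_measure_integrable_cst.
have irY : P.-integrable setT (fun w => r%:E * (Y w)%:E)%E.
  exact: integrableZl.
have icY : P.-integrable setT (fun w => c%:E * (Y w ^+ 2)%:E)%E.
  exact: integrableZl.
pose g w := (1%:E + r%:E * (Y w)%:E + c%:E * (Y w ^+ 2)%:E)%E.
have mg : measurable_fun setT g.
  by apply: (measurable_int P); apply: integrableD => //; exact: integrableD.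
apply: (@le_trans _ _ (\int[P]_w g w)%E).
  apply: ge0_le_integral => //.
  - apply/measurable_EFinP; apply: measurableT_comp => //.
    apply: measurable_funM => //; apply: measurableT_comp => //.
    exact: measurable_truncate_above.
  - by move=> w _; rewrite /g -!EFinM -!EFinD lee_fin.
rewrite /g integralD//; last exact: integrableD.
rewrite integralD// !integralZl// integral_cst//= probability_setT mule1.
apply: (@le_trans _ _ (1 + c * s2)%:E); last by rewrite lee_fin expR_ge1Dx.
rewrite EFinD leeD//; last first.
  by rewrite (EFinM c); apply: lee_wpmul2l; rewrite ?lee_fin.
by rewrite -[leRHS]adde0 leeD2l// mule_ge0_le0// lee_fin.
Qed.

Lemma ge0_integral_identically_distributed d (T : measurableType d)
    (R : realType) (P : probability T R) (I : Type) (Y : I -> {RV P >-> R})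
    (f : R -> \bar R) (i j : I) :
  identically_distributed Y ->
  measurable_fun [set: R] f -> (forall x, 0 <= f x)%E ->
  (\int[P]_w f (Y i w) = \int[P]_w f (Y j w))%E.
Proof.
move=> Yid mf f0.
rewrite -[LHS](ge0_integral_distribution (Y i))//.
rewrite -[RHS](ge0_integral_distribution (Y j))//.
by apply: eq_measure_integral => A mA _; exact: Yid.
Qed.

Lemma iid_comp d (T : measurableType d) (R : realType)
    (P : probability T R) (I : choiceType) (Y : I -> {RV P >-> R})
    (f : {mfun R >-> R}) :
  iid Y -> iid (fun i => (f \o Y i : {mfun T >-> R}) : {RV P >-> R}).
Proof.
move=> [Yi Yid]; have mf A : measurable A -> measurable (f @^-1` A).
  by move=> mA; exact: measurable_funPTI.
split=> [s A us mA|i j A mA]; last exact: Yid (mf _ mA).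
by rewrite -(Yi s (fun i => f @^-1` A i))// => i; exact: mf.
Qed.

Lemma measure_bigcup_nat_le d (T : measurableType d) (R : realType)
    (P : probability T R) (F : nat -> set T) (m n : nat) :
  (forall k, measurable (F k)) ->
  (P (\bigcup_(k in [set k | (m <= k < n)%N]) F k)
   <= \sum_(m <= k < n) P (F k))%E.
Proof.
move=> mF.
have -> : \bigcup_(k in [set k | (m <= k < n)%N]) F k =
    \big[setU/set0]_(i < n - m) F (m + i)%N.
  rewrite -(bigcup_mkord (n - m) (fun i => F (m + i)%N)).
  apply/seteqP; split=> [w [k /= /andP[mk kn] Fk]|w [i /= im Fi]].
    exists (k - m)%N => /=; last by rewrite subnKC.
    exact: ltn_sub2r (leq_ltn_trans mk kn) kn.
  by exists (m + i)%N => //=; rewrite leq_addr/= -ltn_subRL.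
rewrite -{1}[m in (\sum_(m <= _ < _) _)%E]add0n big_addn big_mkord.
under [leRHS]eq_bigr do rewrite addnC.
apply: (@content_subadditive _ _ _ P _ (fun i => F (m + i)%N)) => //.
by apply: bigsetU_measurable.
Qed.

(** Either some [Y k] exceeds [b], which the union bound and equality of laws control, or the
    truncated sum equals the original one and Chernoff's bound applies to it. *)
Lemma sum_tail_bound d (T : measurableType d) (R : realType)
    (P : probability T R) (Y : nat -> {RV P >-> R}) (s2 b r a : R) (n : nat) :
  iid Y -> 0 <= b -> 0 < r ->
  P.-integrable setT (EFin \o Y 0%N) ->
  P.-integrable setT (fun w => (Y 0%N w ^+ 2)%:E) ->
  (\int[P]_w (Y 0%N w)%:E <= 0)%E ->
  (\int[P]_w (Y 0%N w ^+ 2)%:E <= s2%:E)%E ->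
  (P [set w | (a <= \sum_(1 <= k < n.+1) Y k w)%R] <=
   (expR (n%:R * (r ^+ 2 * expR (r * b) * s2) - r * a))%:E
   + n%:R%:E * P [set w | b < Y 0%N w]%R)%E.
Proof.
move=> Yiid b0 r0 iY iY2 EY EY2; have [Yi Yid] := Yiid.
pose tr : {mfun R >-> R} := HB.pack (truncate_above b)
  (isMeasurableFun.Build _ _ _ _ _ (measurable_truncate_above b)).
pose Z k : {RV P >-> R} := (tr \o Y k : {mfun T >-> R}).
have [Zi _] : iid Z by exact: iid_comp.
pose S w := \sum_(1 <= k < n.+1) Z k w.
pose SM : {RV P >-> R} :=
  HB.pack S (isMeasurableFun.Build _ _ _ _ S (measurable_partial_sum Z n)).
pose F k := [set w | b < Y k w]%R.
have mF k : measurable (F k).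
  rewrite (_ : F k = Y k @^-1` `]b, +oo[) //; first exact: measurable_funPTI.
  by apply/seteqP; split=> w /=; rewrite in_itv/= andbT.
have mS (V : nat -> {mfun T >-> R}) :
    measurable [set w | (a <= \sum_(1 <= k < n.+1) V k w)%R].
  rewrite (_ : [set w | _] =
    (fun w => \sum_(1 <= k < n.+1) V k w) @^-1` `[a, +oo[); last first.
    by apply/seteqP; split=> w /=; rewrite in_itv/= andbT.
  by rewrite -[X in measurable X]setTI; exact: measurable_partial_sum.
have PF k : P (F k) = P (F 0%N).
  have FE i : F i = Y i @^-1` `]b, +oo[.
    by apply/seteqP; split=> w /=; rewrite in_itv/= andbT.
  by rewrite !FE; exact: (Yid k 0%N).
have mbig : measurable (\bigcup_(k in [set k | (1 <= k < n.+1)%N]) F k).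
  exact: bigcup_measurable.
apply: (@le_trans _ _ (P ([set w | a <= SM w]%R `|`
    \bigcup_(k in [set k | (1 <= k < n.+1)%N]) F k))).
  apply: le_measure; rewrite ?inE; [exact: mS| |].
    by apply: measurableU => //; exact: (mS Z).
  move=> w /= aS; have [[k kn bY]|noF] :=
      pselect ((\bigcup_(k in [set k | (1 <= k < n.+1)%N]) F k) w).
    by right; exists k.
  left; rewrite /SM/= /S (le_trans aS)//.
  rewrite le_eqVlt; apply/orP; left; apply/eqP/eq_big_nat => k kn.
  rewrite /Z/= /truncate_above; case: leP => // bY.
  by exfalso; apply: noF; exists k.
apply: (le_trans (measureU2 _ _ _)) => //; first exact: (mS Z).
apply: leeD; last first.
  apply: (le_trans (measure_bigcup_nat_le _ _ _ mF)).
  under eq_bigr do rewrite PF.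
  by rewrite big_const_nat iter_addr_0 subn1/= mule_natl.
apply: (le_trans (chernoff SM a r0)).
have -> : 'M_P SM r = (\prod_(1 <= k < n.+1) \int[P]_w (expR (r * Z k w))%:E)%E.
  rewrite -mmt_gen_fun_sum// /mmt_gen_fun unlock.
  by apply: eq_integral => w _ /=; rewrite mulrC.
set M := expR (r ^+ 2 * expR (r * b) * s2).
apply: (@le_trans _ _ ((M ^+ n)%:E * (expR (- (r * a)))%:E)%E); last first.
  by rewrite -EFinM lee_fin expRD expRM_natl.
apply: lee_wpmul2r; first by rewrite lee_fin expR_ge0.
have mexp : measurable_fun [set: R]
    (fun x => (expR (r * truncate_above b x))%:E).
  apply/measurable_EFinP; apply: measurableT_comp => //.
  by apply: measurable_funM => //; exact: measurable_truncate_above.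
have EZ k : (\int[P]_w (expR (r * Z k w))%:E <= M%:E)%E.
  have -> : (\int[P]_w (expR (r * Z k w))%:E =
             \int[P]_w (expR (r * Z 0%N w))%:E)%E.
    apply: (ge0_integral_identically_distributed k 0%N Yid mexp).
    by move=> x; rewrite lee_fin expR_ge0.
  by apply: mmt_gen_fun_truncate_above => //; exact: ltW.
have EZ0 k : (0 <= \int[P]_w (expR (r * Z k w))%:E)%E.
  by apply: integral_ge0 => w _; rewrite lee_fin expR_ge0.
elim: n {S SM mS mbig} => [|n IH]; first by rewrite big_geq// expr0.
rewrite big_nat_recr//= exprSr EFinM; apply: lee_pmul => //.
- by apply: prode_ge0 => k _; exact: EZ0.
- exact: EZ0.
- exact: EZ.
Qed.

(** * Deviations of order n have probability o(1/n) *)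

(** Dominated convergence: [n%:R ^+ 2] times the indicator of the event vanishes once
    [delta * n%:R >= Y w], and it never exceeds [delta ^- 2 * Y w ^+ 2]. *)
Lemma cvg_sqr_tail d (T : measurableType d) (R : realType)
    (P : probability T R) (Y : {RV P >-> R}) (delta : R) :
  0 < delta ->
  P.-integrable setT (fun w => (Y w ^+ 2)%:E) ->
  ((n%:R ^+ 2)%:E * P [set w | delta * n%:R < Y w]%R)%E @[n --> \oo] --> 0%E.
Proof.
move=> delta0 iY2.
pose F (n : nat) := [set w | delta * n%:R < Y w]%R.
have mF n : measurable (F n).
  rewrite (_ : F n = Y @^-1` `]delta * n%:R, +oo[).
    exact: measurable_funPTI.
  by apply/seteqP; split=> w /=; rewrite in_itv/= andbT.
pose f (n : nat) w : \bar R := ((n%:R ^+ 2)%:E * (\1_(F n) w)%:E)%E.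
have fE n : (\int[P]_w f n w = (n%:R ^+ 2)%:E * P (F n))%E.
  rewrite /f ge0_integralZl//.
  - by rewrite integral_indic// setIT.
  - by apply/measurable_EFinP; exact: measurable_indic.
have mf n : measurable_fun setT (f n).
  apply/measurable_EFinP.
  by apply: measurable_funM => //; exact: measurable_indic.
have f0 w : f ^~ w @ \oo --> 0%E.
  apply: cvg_near_cst; near=> n; rewrite /f indicE memNset ?mule0//.
  apply/negP; rewrite -leNgt -ler_pdivrMl//.
  near: n; exact: nbhs_infty_ger.
have fg w n : (`|f n w| <= (delta ^- 2)%:E * (Y w ^+ 2)%:E)%E.
  rewrite /f -!EFinM abse_EFin lee_fin ger0_norm; last first.
    by rewrite mulr_ge0// sqr_ge0.
  rewrite indicE; have [/set_mem Fnw|_] := boolP (w \in F n); last first.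
    by rewrite mulr0 mulr_ge0// ?invr_ge0 sqr_ge0.
  rewrite mulr1 ler_pdivlMl ?exprn_gt0// -exprMn.
  have dn0 : 0 <= delta * n%:R by rewrite mulr_ge0// ltW.
  by rewrite lerXn2r ?nnegrE// ltW// (le_lt_trans dn0).
have [_ _] := @dominated_convergence _ _ _ P setT measurableT f (cst 0%E)
  (fun w => (delta ^- 2)%:E * (Y w ^+ 2)%:E)%E mf (measurable_cst _)
  (aeW _ (fun w _ => f0 w)) (integrableZl measurableT _ iY2)
  (aeW _ (fun w n _ => fg w n)).
by rewrite integral0; under eq_fun do rewrite fE.
Unshelve. all: by end_near. Qed.

(** Squaring [x / 4 <= expR (x / 4)] gives it. With [x = ln n] it bounds the squared logarithm by a
    multiple of the square root of [n]. *)
Lemma sqr_le_expR_half (R : realType) (x : R) :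
  0 <= x -> x ^+ 2 <= 16 * expR (x / 2).
Proof.
move=> x0.
have -> : expR (x / 2) = expR (x / 4) ^+ 2.
  by rewrite -expRM_natl; congr expR; field.
have e : x / 4 <= expR (x / 4) by have := expR_ge1Dx (x / 4); lra.
have : (x / 4) ^+ 2 <= expR (x / 4) ^+ 2.
  by rewrite lerXn2r ?nnegrE ?expR_ge0//; lra.
by rewrite expr_div_n; lra.
Qed.

(* Chernoff's parameter [2 ln n / (c n)] against a truncation at [c n / 4]. *)
Lemma chernoff_exponent_bound (R : realType) (c s2 r : R) (n : nat) :
  (0 < n)%N -> 0 < c -> 0 <= s2 -> r = 2 * ln n%:R / (c * n%:R) ->
  n%:R * expR (n%:R * (r ^+ 2 * expR (r * (c / 4 * n%:R)) * s2)
               - r * (c * n%:R))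
  <= expR (64 * s2 / c ^+ 2) / n%:R.
Proof.
move=> n0 c0 s20.
have N0 : 0 < n%:R :> R by rewrite ltr0n.
set L := ln n%:R.
have L0 : 0 <= L by rewrite ln_ge0// ler1n.
have nE : n%:R = expR L by rewrite lnK// posrE.
set N : R := n%:R in N0 nE *; move=> rE.
have Nn : N != 0 by rewrite gt_eqF.
have cn : c != 0 by rewrite gt_eqF.
(* Truncation costs a factor [expR (L / 2)], the square root of [n], inside the exponent. The
   deviation contributes [expR (- (L + L))], that is [n ^- 2], and the leading [n] cancels one
   power. *)
have -> : r * (c / 4 * N) = L / 2 by rewrite rE; field; rewrite cn Nn.
have -> : r * (c * N) = L + L by rewrite rE; field; rewrite cn Nn.
rewrite expRD expRN expRD -nE.
set x := N * (_ * s2); have -> : N * (expR x / (N * N)) = expR x / N by field.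
rewrite ler_pM2r ?invr_gt0// ler_expR /x.
have EE : N = expR (L / 2) ^+ 2 by rewrite nE -expRM_natl; congr expR; field.
set E := expR (L / 2) in EE *.
have E0 : 0 < E by exact: expR_gt0.
have En : E != 0 by rewrite gt_eqF.
(* What remains is [L ^+ 2] over the square root of [n], at most 16; this is where [64 = 4 * 16]
   comes from. *)
have -> : N * (r ^+ 2 * E * s2) = 4 * s2 / c ^+ 2 * (L ^+ 2 / E).
  by rewrite rE EE; field; rewrite cn En.
have -> : 64 * s2 / c ^+ 2 = 4 * s2 / c ^+ 2 * 16 by field.
apply: ler_wpM2l; first by rewrite divr_ge0 ?sqr_ge0// mulr_ge0.
by rewrite ler_pdivrMr//; exact: sqr_le_expR_half.
Qed.

(** In [sum_tail_bound] the cut grows linearly in [n]. After multiplication by [n], the Chernoff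
    term is O(1/n) and the union bound carries [n ^ 2], which [cvg_sqr_tail] handles. *)
Lemma iid_sum_tail_little_o d (T : measurableType d) (R : realType)
    (P : probability T R) (Y : nat -> {RV P >-> R}) (c : R) :
  iid Y -> 0 < c ->
  P.-integrable setT (EFin \o Y 0%N) ->
  P.-integrable setT (fun w => (Y 0%N w ^+ 2)%:E) ->
  (\int[P]_w (Y 0%N w)%:E <= 0)%E ->
  (n%:R%:E * P [set w | (c * n%:R <= \sum_(1 <= k < n.+1) Y k w)%R])%E
    @[n --> \oo] --> 0%E.
Proof.
move=> Yiid c0 iY iY2 EY.
pose s2 := fine (\int[P]_w (Y 0%N w ^+ 2)%:E)%E.
have Es2 : (\int[P]_w (Y 0%N w ^+ 2)%:E <= s2%:E)%E.
  by rewrite fineK// integrable_fin_num.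
have s20 : 0 <= s2.
  by rewrite fine_ge0// integral_ge0// => w _; rewrite lee_fin sqr_ge0.
(* The factor 2 pays for the shift in [harmonic n], which is [1 / (n + 1)]: for [n >= 1],
   [1 / n <= 2 / (n + 1)]. *)
pose K := 2 * expR (64 * s2 / c ^+ 2).
pose G (n : nat) := ((K * harmonic n)%:E +
  (n%:R ^+ 2)%:E * P [set w | c / 4 * n%:R < Y 0%N w]%R)%E.
apply: (@squeeze_cvge _ _ _ _ (cst 0%E) _ G); last 2 first.
- exact: cvg_cst.
- rewrite -[0%E]adde0; apply: cvgeD => //; last first.
    by apply: cvg_sqr_tail => //; rewrite divr_gt0.
  have -> : (0 = (K * 0)%:E :> \bar R)%E by rewrite mulr0.
  by apply: cvg_EFin; [exact: nearW|apply: cvgMl_tmp; exact: cvg_harmonic].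
near=> n; apply/andP; split; first by rewrite mule_ge0// lee_fin.
(* Beyond [n = 1] the logarithm is positive, hence so is Chernoff's parameter. *)
have n2 : (1 < n)%N by near: n; exact: nbhs_infty_gt.
have N0 : 0 < n%:R :> R by rewrite ltr0n (ltn_trans _ n2).
pose r := 2 * ln n%:R / (c * n%:R).
have r0 : 0 < r by rewrite divr_gt0// ?mulr_gt0// ln_gt0// ltr1n.
have b0 : 0 <= c / 4 * n%:R by rewrite mulr_ge0// divr_ge0// ltW.
have H := sum_tail_bound (c * n%:R) n Yiid b0 r0 iY iY2 EY Es2.
apply: (le_trans (lee_wpmul2l _ H)); first by rewrite lee_fin ltW.
rewrite ge0_muleDr ?lee_fin ?expR_ge0//; last by rewrite mule_ge0// lee_fin ltW.
rewrite -EFinM muleA -EFinM -expr2 leeD2r// lee_fin.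
apply: (le_trans (chernoff_exponent_bound (ltnW n2) c0 s20 erefl)).
rewrite /K; set e := expR _.
rewrite [2 * e]mulrC -mulrA; apply: ler_wpM2l; first exact: expR_ge0.
rewrite /harmonic/=.
rewrite -[n.+1%:R]natr1 ler_pdivlMr; last by rewrite ltr_wpDl// ltW.
rewrite mulrC ler_pdivrMr//.
have : 1 <= n%:R :> R by rewrite ler1n ltnW.
lra.
Unshelve. all: by end_near. Qed.

(** * Joint laws and independent copies *)

Lemma sigma_family_bigcap (T : pointedType) (R : realType) (I : choiceType)
    (X : I -> T -> R) (s : seq I) (A : I -> set R) :
  (forall i, measurable (A i)) ->
  sigma_family X (\bigcap_(i in [set` s]) (X i @^-1` A i)).
Proof.
move=> mA.
pose G := \bigcup_(i in [set: I]) preimage_set_system setT (X i) measurable.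
apply: (@fin_bigcap_measurable _ (g_sigma_algebraType G)) => [|i _].
  exact: finite_seq.
by apply: sub_sigma_algebra; exists i => //; exists (A i) => //; rewrite setTI.
Qed.

Lemma same_joint_distribution_bigcap d (T : measurableType d) (R : realType)
    (P : probability T R) (I : choiceType) (X X' : I -> {RV P >-> R})
    (s : seq I) (A : I -> set R) :
  same_joint_distribution X X' -> (forall i, measurable (A i)) ->
  P (\bigcap_(i in [set` s]) (X i @^-1` A i)) =
  P (\bigcap_(i in [set` s]) (X' i @^-1` A i)).
Proof.
move=> XX' mA.
(* The cylinder σ-algebra is the [sigma_family] of the coordinate maps, so finite intersections of
   coordinate events belong to it. *)
pose proj (i : I) (x : I -> R) := x i.
have := XX' _ (sigma_family_bigcap (X := proj) s mA).
by rewrite !preimage_bigcap.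
Qed.

Lemma same_joint_distribution_preimage d (T : measurableType d) (R : realType)
    (P : probability T R) (I : choiceType) (X X' : I -> {RV P >-> R})
    (i : I) (A : set R) :
  same_joint_distribution X X' -> measurable A ->
  P (X i @^-1` A) = P (X' i @^-1` A).
Proof.
move=> XX' mA.
have := same_joint_distribution_bigcap [:: i] XX' (fun=> mA).
by rewrite !bigcap_seq_cons set_nil !bigcap_set0 !setIT.
Qed.

(** The pairs [(X i, X' i)] are i.i.d.: on rectangles, probabilities factor first between the two
    families, then within each, [X'] inheriting this from [X] through the joint law. Suitable [h]
    give both that [X'] is i.i.d. and that the products are. *)
Lemma iid_comp_independent_copy d (T : measurableType d) (R : realType)
    (P : probability T R) (I : choiceType) (X X' Y : I -> {RV P >-> R})
    (h : R * R -> R) :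
  iid X -> independent_copy X X' -> measurable_fun setT h ->
  (forall i w, Y i w = h (X i w, X' i w)) -> iid Y.
Proof.
move=> [Xi Xid] [XX'i XX'] mh Yh.
pose W0 i w := (X i w, X' i w).
have mW0 i : measurable_fun setT (W0 i) by exact: measurable_fun_pair.
pose W i : {mfun T >-> (R * R)%type} :=
  HB.pack (W0 i) (isMeasurableFun.Build _ _ _ _ (W0 i) (mW0 i)).
have rect s A B : uniq s -> (forall i, measurable (A i)) ->
    (forall i, measurable (B i)) ->
    (P (\bigcap_(i in [set` s]) (W i @^-1` (A i `*` B i))) =
     \prod_(i <- s) (P (X i @^-1` A i) * P (X' i @^-1` B i)))%E.
  move=> us mA mB.
  have -> : \bigcap_(i in [set` s]) (W i @^-1` (A i `*` B i)) =
      \bigcap_(i in [set` s]) (X i @^-1` A i) `&`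
      \bigcap_(i in [set` s]) (X' i @^-1` B i).
    by rewrite -bigcapI.
  rewrite XX'i; [|exact: sigma_family_bigcap..].
  rewrite big_split/= Xi// -(same_joint_distribution_bigcap s XX')// Xi//.
  congr (_ * _)%E; apply: eq_bigr => i _.
  exact: same_joint_distribution_preimage.
have rect1 i A B : measurable A -> measurable B ->
    (P (W i @^-1` (A `*` B)) = P (X i @^-1` A) * P (X' i @^-1` B))%E.
  move=> mA mB.
  have := rect [:: i] (fun=> A) (fun=> B) isT (fun=> mA) (fun=> mB).
  by rewrite bigcap_seq_cons set_nil bigcap_set0 setIT big_seq1.
have YW i A : Y i @^-1` A = W i @^-1` (h @^-1` A).
  by apply/seteqP; split=> w /=; rewrite Yh.
have mhA A : measurable A -> measurable (h @^-1` A).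
  by move=> mA; rewrite -[X in measurable X]setTI; exact: mh.
split=> [s A us mA|i j A mA].
  under eq_bigcapr do rewrite YW.
  under eq_bigr do rewrite YW.
  apply: (@independent_seq_rectangles _ _ _ _ _ _ _ _ _ W _ s
    (fun i => h @^-1` A i)) => //.
    move=> {}s {}A B {}us {}mA mB; rewrite rect//.
    by apply: eq_bigr => i _; rewrite rect1.
  by move=> i; exact: mhA.
rewrite /distribution /pushforward !YW.
apply: (@eq_measure_rectangles _ _ _ _ _
  (distribution P (W i)) (distribution P (W j))).
- exact: le_lt_trans (probability_le1 _ _) (ltry _).
- move=> {}A B {}mA mB; rewrite [LHS]rect1// [RHS]rect1//.
  rewrite -!(same_joint_distribution_preimage _ XX')//.
  by congr (_ * _)%E; exact: Xid.
- exact: mhA.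
Qed.

(** * Means of products and lower tails of sums of squares *)

(** Tonelli's theorem for absolute values gives integrability. For the signed product, Fubini's
    theorem on the product law leaves inner integrals [x] times the mean of [V], all zero. *)
Lemma integral_mul_independent_eq0 d (T : measurableType d) (R : realType)
    (P : probability T R) (U V : {RV P >-> R}) :
  (forall A B, measurable A -> measurable B ->
    P (U @^-1` A `&` V @^-1` B) = P (U @^-1` A) * P (V @^-1` B))%E ->
  P.-integrable setT (EFin \o U) -> P.-integrable setT (EFin \o V) ->
  (\int[P]_w (V w)%:E = 0)%E ->
  P.-integrable setT (fun w => (U w * V w)%:E) /\
  (\int[P]_w (U w * V w)%:E = 0)%E.
Proof.
move=> UV iU iV EV.
have mabs : measurable_fun [set: R] (fun x : R => `|x%:E|%E).
  exact: measurableT_comp.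
have iUV : P.-integrable setT (fun w => (U w * V w)%:E).
  apply/integrableP; split.
    by apply/measurable_EFinP; exact: measurable_funM.
  under eq_integral do rewrite EFinM abseM.
  rewrite (expectation_prod_independent UV mabs mabs)//.
  have /integrableP[_ fU] := iU; have /integrableP[_ fV] := iV.
  by rewrite lte_mul_pinfty// ?integral_ge0// ge0_fin_numE// integral_ge0.
split => //.
pose W w := (U w, V w).
have mW : measurable_fun setT W by exact: measurable_fun_pair.
pose WM : {mfun T >-> (R * R)%type} :=
  HB.pack W (isMeasurableFun.Build _ _ _ _ W mW).
pose h (z : R * R) := (z.1 * z.2)%:E.
have mh : measurable_fun [set: R * R] h.
  by apply/measurable_EFinP; exact: measurable_funM.
have WE D : measurable D -> D `<=` setT -> distribution P WM D =
    (distribution P U \x distribution P V)%E D.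
  move=> mD _; apply/esym.
  by apply: product_measure_unique => // A B mA mB; exact: UV.
have -> : (\int[P]_w (U w * V w)%:E = \int[distribution P WM]_z h z)%E.
  by rewrite integral_distribution.
rewrite (eq_measure_integral (distribution P U \x distribution P V)%E)//.
have ih : (distribution P U \x distribution P V)%E.-integrable setT h.
  apply/integrableP; split => //.
  rewrite -(eq_measure_integral _ WE) ge0_integral_distribution//.
    by have /integrableP[] := iUV.
  exact: measurableT_comp.
rewrite -integral12_prod_meas1//.
apply: integral0_eq => x _; rewrite /fubini_F /h/=.
have ixV : P.-integrable setT (fun w => (x%:E * (V w)%:E)%E).
  exact: integrableZl.
rewrite (@integral_distribution _ _ _ _ _ P V (fun y => (x * y)%:E))//.
  by under eq_integral do rewrite /= EFinM; rewrite integralZl// EV mule0.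
by apply/measurable_EFinP; exact: mulrl_measurable.
Qed.

(** The squares may lack a second moment, but [phi (V k)] is bounded. With [M] its mean,
    [M - phi (V k)] is centred, and a sum of squares at most [M / 2 * n%:R] forces the centred sum
    up to [M / 2 * n%:R]. *)
Lemma sum_sqr_lower_tail d (T : measurableType d) (R : realType)
    (P : probability T R) (V : nat -> {RV P >-> R}) :
  iid V -> (\int[P]_w (V 0%N w ^+ 2)%:E != 0)%E ->
  exists2 m : R, 0 < m &
    (n%:R%:E * P [set w | (\sum_(1 <= k < n.+1) V k w ^+ 2 <= m * n%:R)%R])%E
      @[n --> \oo] --> 0%E.
Proof.
move=> Viid EV2.
pose phi (x : R) := Num.min (x ^+ 2) 1.
have phi0 x : 0 <= phi x by rewrite le_min sqr_ge0 ler01.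
have phi1 x : phi x <= 1 by rewrite ge_min lexx orbT.
have phi2 x : phi x <= x ^+ 2 by rewrite ge_min lexx.
have mphi : measurable_fun [set: R] phi.
  by apply: measurable_minr => //; exact: exprn_measurable.
have mphiV : measurable_fun setT (fun w => (phi (V 0%N w))%:E).
  by apply/measurable_EFinP; exact: measurableT_comp.
have i1 (c : R) : P.-integrable setT (fun=> c%:E).
  exact: finite_measure_integrable_cst.
have iphi : P.-integrable setT (fun w => (phi (V 0%N w))%:E).
  apply: le_integrable (i1 1) => //.
  by move=> w _; rewrite !abse_EFin lee_fin normr1 ger0_norm.
pose M := fine (\int[P]_w (phi (V 0%N w))%:E)%E.
have ME : (\int[P]_w (phi (V 0%N w))%:E = M%:E)%E.
  by rewrite fineK// integrable_fin_num.
have M0 : 0 < M.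
  rewrite lt_neqAle; apply/andP; split; last first.
    by apply/fine_ge0/integral_ge0 => w _; rewrite lee_fin.
  (* If [M] were zero, [phi (V 0)] would vanish almost everywhere, hence so would [V 0 ^+ 2], as the
     minimum with 1 has the same zeros. *)
  apply: contra_neq EV2 => M0.
  have phiae : ae_eq P setT (fun w => (phi (V 0%N w))%:E) (cst 0%E).
    apply/ae_eq_integral_abs => //.
    by under eq_integral do rewrite abse_EFin ger0_norm//; rewrite ME -M0.
  rewrite (ae_eq_integral (cst 0%E))//; first exact: integral0.
    by apply/measurable_EFinP; exact: measurable_funX.
  apply: filterS phiae => w H _.
  have : phi (V 0%N w) = 0 by apply: EFin_inj; exact: H.
  by rewrite /phi minEle; case: ifP => [_ ->//|_ /eqP]; rewrite oner_eq0.
pose h x := M - phi x.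
have mh : measurable_fun [set: R] h by exact: measurable_funB.
pose hM : {mfun R >-> R} := HB.pack h (isMeasurableFun.Build _ _ _ _ h mh).
pose Y k : {RV P >-> R} := (hM \o V k : {mfun T >-> R}).
have M20 : 0 < M / 2 by rewrite divr_gt0.
exists (M / 2) => //.
have tail : (n%:R%:E * P [set w | (M / 2 * n%:R <=
    \sum_(1 <= k < n.+1) Y k w)%R])%E @[n --> \oo] --> 0%E.
  apply: iid_sum_tail_little_o => //; first exact: iid_comp.
  - rewrite (_ : EFin \o _ = fun w => (M%:E - (phi (V 0%N w))%:E)%E)//.
    exact: integrableB.
  - apply: (le_integrable measurableT _ _ (i1 ((M + 1) ^+ 2))).
      by apply/measurable_EFinP; exact: measurable_funX.
    move=> w _; rewrite !abse_EFin lee_fin !ger0_norm ?sqr_ge0//.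
    have h1 : `|h (V 0%N w)| <= M + 1.
      rewrite /h ler_norml.
      by have := phi0 (V 0%N w); have := phi1 (V 0%N w); lra.
    by rewrite -[leLHS]real_normK ?num_real// lerXn2r// nnegrE; lra.
  - rewrite (_ : (fun w => _) = fun w => (M%:E - (phi (V 0%N w))%:E)%E)//.
    by rewrite integralB// integral_cst//= probability_setT mule1 ME subee.
apply: (squeeze_cvge _ (cvg_cst 0%E) tail).
apply: nearW => n; apply/andP; split; first by rewrite mule_ge0// lee_fin.
apply: lee_wpmul2l; first by rewrite lee_fin.
have mV : measurable_fun setT (fun w => \sum_(1 <= k < n.+1) V k w ^+ 2).
  by apply: measurable_sum => k; exact: measurable_funX.
apply: le_measure; rewrite ?inE.
- rewrite -[X in measurable X]setTI.
  exact: measurable_fun_le.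
- rewrite -[X in measurable X]setTI.
  by apply: measurable_fun_le => //; exact: measurable_partial_sum.
- move=> w /= H.
  have -> : \sum_(1 <= k < n.+1) Y k w
      = M * n%:R - \sum_(1 <= k < n.+1) phi (V k w).
    transitivity (\sum_(1 <= k < n.+1) (M - phi (V k w))) => //.
    by rewrite sumrB sumr_const_nat subn1 mulr_natr.
  have : \sum_(1 <= k < n.+1) phi (V k w) <= \sum_(1 <= k < n.+1) V k w ^+ 2.
    exact: ler_sum.
  by move: H; lra.
Qed.

(** * The ratio of the two sums *)

Unset Implicit Arguments.

(* The family {X, X_n; n >= 1} is indexed by nat: X 0 is the generic variable X
   and X n is X_n for n >= 1; likewise for X'. *)
Theorem lemma2p3 (d : measure_display) (T : measurableType d) (R : realType)
    (P : probability T R) (X X' : nat -> {RV P >-> R})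
    (X_iid : iid X)
    (EX : ('E_P[X 0%N] = 0)%E)
    (EX2 : ('E_P[(fun w => X 0%N w ^+ 2)%R] = 1)%E)
    (X'_copy : independent_copy X X')
    (eps : R) (eps_gt0 : 0 < eps) :
  (n%:R%:E * (1 - P [set w | (1 - eps <
       (\sum_(1 <= k < n.+1) (X k w - X' k w) ^+ 2)
       / (\sum_(1 <= k < n.+1) X k w ^+ 2))%R]))%E @[n --> \oo] --> 0%E.
Proof.
rewrite unlock in EX; rewrite unlock in EX2.
have [XX'i XX'] := X'_copy.
(* [X'] stands first so that the factor required to be centred in [integral_mul_independent_eq0] is
   [X], whose mean is given. *)
have indep A B : measurable A -> measurable B ->
    (P (X' 0%N @^-1` A `&` X 0%N @^-1` B)
     = P (X' 0%N @^-1` A) * P (X 0%N @^-1` B))%E.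
  move=> mA mB; rewrite setIC muleC; apply: XX'i.
    have := sigma_family_bigcap (X := fun i => X i : T -> R)
      [:: 0%N] (fun=> mB).
    by rewrite bigcap_seq_cons set_nil bigcap_set0 setIT.
  have := sigma_family_bigcap (X := fun i => X' i : T -> R)
    [:: 0%N] (fun=> mA).
  by rewrite bigcap_seq_cons set_nil bigcap_set0 setIT.
have msqr : measurable_fun [set: R] (fun x : R => (x ^+ 2)%:E).
  by apply/measurable_EFinP; exact: exprn_measurable.
have sqr_ge0E (x : R) : (0 <= (x ^+ 2)%:E)%E by rewrite lee_fin sqr_ge0.
have EX'2 : (\int[P]_w (X' 0%N w ^+ 2)%:E = 1)%E.
  rewrite -EX2.
  rewrite -[LHS](@ge0_integral_distribution _ _ _ _ _ _ (X' 0%N) _ msqr)//.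
  rewrite -[RHS](@ge0_integral_distribution _ _ _ _ _ _ (X 0%N) _ msqr)//.
  apply: eq_measure_integral => A mA _; apply/esym.
  exact: (same_joint_distribution_preimage 0%N XX' mA).
have integrable1 (V : {RV P >-> R}) : (\int[P]_w (V w ^+ 2)%:E = 1)%E ->
    P.-integrable setT (EFin \o V).
  move=> EV.
  have iV2 : P.-integrable setT (fun w => (V w ^+ 2)%:E).
    apply/integrableP; split; first exact: (measurableT_comp msqr).
    by under eq_integral do rewrite gee0_abs//; rewrite EV ltry.
  have i1 : P.-integrable setT (fun=> 1%:E).
    exact: finite_measure_integrable_cst.
  have iD : P.-integrable setT (fun w => (1 + V w ^+ 2)%:E).
    exact: (integrableD measurableT i1 iV2).
  apply: (le_integrable measurableT _ _ iD); first exact/measurable_EFinP.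
  move=> w _; rewrite /= lee_fin.
  rewrite [leRHS]ger0_norm; last by rewrite addr_ge0// sqr_ge0.
  rewrite -[V w ^+ 2]real_normK ?num_real//.
  (* The square gives [|V w| <= V w ^+ 2 + 1 / 4]. *)
  by have := sqr_ge0 (`|V w| - 2^-1); rewrite sqrrB; lra.
have iX := integrable1 _ EX2.
have iX' := integrable1 _ EX'2.
have [iX'X EX'X] := integral_mul_independent_eq0 indep iX' iX EX.
have X'_iid : iid X'.
  exact: (iid_comp_independent_copy X_iid X'_copy measurable_snd).
have EX2_neq0 : (\int[P]_w (X 0%N w ^+ 2)%:E != 0)%E by rewrite EX2 onee_neq0.
have EX'2_neq0 : (\int[P]_w (X' 0%N w ^+ 2)%:E != 0)%E.
  by rewrite EX'2 onee_neq0.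
have [a a0 tX] := sum_sqr_lower_tail X_iid EX2_neq0.
have [b b0 tX'] := sum_sqr_lower_tail X'_iid EX'2_neq0.
pose XX k : {RV P >-> R} := (X' k \* X k : {mfun T >-> R}).
have tXX : (n%:R%:E * P [set w | (b / 2 * n%:R <=
    \sum_(1 <= k < n.+1) XX k w)%R])%E @[n --> \oo] --> 0%E.
  apply: iid_sum_tail_little_o.
  - apply: (iid_comp_independent_copy (h := fun z => z.2 * z.1)
      X_iid X'_copy) => //.
    exact: measurable_funM.
  - by rewrite divr_gt0.
  - exact: iX'X.
  - apply/integrableP; split.
      by apply/measurable_EFinP; exact: measurable_funX.
    under eq_integral do rewrite gee0_abs// exprMn EFinM.
    rewrite (expectation_prod_independent indep msqr msqr)//.
    by rewrite EX2 EX'2 mule1 ltry.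
  - by rewrite EX'X.
pose Q n w := \sum_(1 <= k < n.+1) X k w ^+ 2.
pose Q' n w := \sum_(1 <= k < n.+1) X' k w ^+ 2.
pose D n w := \sum_(1 <= k < n.+1) (X k w - X' k w) ^+ 2.
pose S n w := \sum_(1 <= k < n.+1) XX k w.
pose G n := [set w | (1 - eps < D n w / Q n w)%R].
have Q0 n w : 0 <= Q n w by apply: sumr_ge0 => k _; exact: sqr_ge0.
have mQ n : measurable_fun setT (Q n).
  by apply: measurable_sum => k; exact: measurable_funX.
have mQ' n : measurable_fun setT (Q' n).
  by apply: measurable_sum => k; exact: measurable_funX.
have mD n : measurable_fun setT (D n).
  by apply: measurable_sum => k; apply: measurable_funX; exact: measurable_funB.
have mG n : measurable (G n).
  (* As [Q n w >= 0], its inverse is the real power with exponent -1, a measurable function; both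
     are [0] where [Q n w] vanishes. *)
  have mDQ : measurable_fun setT (fun w => D n w * (Q n w) `^ (-1)).
    apply: measurable_funM => //.
    exact: (measurableT_comp (measurable_powR (-1)) (mQ n)).
  rewrite (_ : G n = (fun w => D n w * (Q n w) `^ (-1)) @^-1` `]1 - eps, +oo[).
    by rewrite -[X in measurable X]setTI; exact: mDQ.
  by apply/seteqP; split=> w /=; rewrite in_itv/= andbT powR_inv1.
have mle (f g : T -> R) : measurable_fun setT f -> measurable_fun setT g ->
    measurable [set w | f w <= g w].
  by move=> mf mg; rewrite -[X in measurable X]setTI; exact: measurable_fun_le.
pose E1 n := [set w | Q n w <= a * n%:R].
pose E2 n := [set w | Q' n w <= b * n%:R].
pose E3 n := [set w | b / 2 * n%:R <= S n w].
have mE1 n : measurable (E1 n) by exact: mle.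
have mE2 n : measurable (E2 n) by exact: mle.
have mE3 n : measurable (E3 n).
  by apply: mle => //; exact: measurable_partial_sum.
(* Off [E1] the denominator is positive, so failure of the event gives
   [D n w <= (1 - eps) * Q n w <= Q n w]. Expanding the squares in [D] yields [2 * S n w >= Q' n w],
   which exceeds [b * n%:R] off [E2]. *)
have GE n : ~` G n `<=` E1 n `|` E2 n `|` E3 n.
  move=> w nG; have [|q] := leP (Q n w) (a * n%:R); first by left; left.
  have [|q'] := leP (Q' n w) (b * n%:R); first by left; right.
  right; have Qw0 : 0 < Q n w by rewrite (le_lt_trans _ q)// mulr_ge0// ltW.
  move: nG => /negP; rewrite -leNgt ler_pdivrMr// => DQ.
  have {}DQ : D n w <= Q n w.
    by rewrite (le_trans DQ)// ler_piMl// gerBl ltW.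
  have DE : D n w = Q n w - 2 * S n w + Q' n w.
    rewrite mulr_sumr -sumrB -big_split/=; apply: eq_bigr => k _.
    by rewrite /XX/=; ring.
  by rewrite /E3/=; lra.
apply: (@squeeze_cvge _ _ _ _ (cst 0%E) _
  (fun n => n%:R%:E * P (E1 n) + n%:R%:E * P (E2 n) + n%:R%:E * P (E3 n))%E).
- apply: nearW => n; rewrite -(probability_setC _ (mG n)).
  apply/andP; split; first by rewrite mule_ge0// lee_fin.
  rewrite -!ge0_muleDr ?adde_ge0//.
  apply: lee_wpmul2l; first by rewrite lee_fin.
  apply: (@le_trans _ _ (P (E1 n `|` E2 n `|` E3 n))).
    apply: le_measure; rewrite ?inE//; first exact: measurableC.
    by do 2?apply: measurableU => //.
  apply: (le_trans (measureU2 _ _ _)) => //; first exact: measurableU.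
  by rewrite leeD2r// measureU2.
- exact: cvg_cst.
- rewrite -[0%E]adde0 -[X in (X + _)%E]adde0.
  by apply: cvgeD => //; apply: cvgeD.
Qed.
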